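(* Let $(\mathscr{A},\tau)$ be a tracial non commutative probability space and let $P\in\mathscr{A}$ be a self-adjoint projection with $\tau(P)=\alpha$. Then the free cumulants $(\kappa_n(P))_{n\ge1}$ of $P$ are given by $$\kappa_1(P)=\alpha,\qquad \kappa_n(P) = \frac{1}{2(2n-1)}\left[P_{n-2}(1-2\alpha)-P_n(1-2\alpha)\right],\quad n\ge2,$$ where $(P_n)_{n\ge0}$ is the family of Legendre polynomials.
   Context: The Legendre polynomials are $P_n(x) = {}_2F_1\left(-n,n+1,1;\frac{1-x}{2}\right)$, $x\in[-1,1]$, where ${}_2F_1$ is the Gauss hypergeometric function. The free cumulants are the Taylor coefficients of the $R$-transform: $R(y)=\sum_{n\ge0}\kappa_{n+1}(P)y^n$, where $R(y)=K(y)-1/y$ and $K$ is the local inverse (near $y=0$, with $K(y)\sim 1/y$) of the Cauchy transform $z\mapsto\tau[(z-P)^{-1}]$. *)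

(* Defs.v *)
From HB Require Import structures.
From mathcomp Require Import all_boot all_order all_algebra.
From mathcomp Require Import all_classical all_reals all_analysis.
From mathcomp.real_closed Require Import complex.

Set Implicit Arguments.
Unset Strict Implicit.
Unset Printing Implicit Defensive.

Import Order.TTheory GRing.Theory Num.Theory.
Import numFieldNormedType.Exports.

Local Open Scope classical_set_scope.
Local Open Scope ring_scope.

(* The complex numbers, declared at type numClosedFieldType so that they get
   the norm topology available on every numFieldType. *)
Definition Cplx (R : realType) : numClosedFieldType := R[i]%C.

Definition toCplx (R : realType) (x : R) : Cplx R := x%:C%C.

(* Unital *-algebras. Building on unitAlgType only fixes the notation for
   inverses: by excluded middle and choice every nontrivial unital algebra is
   a unitAlgType, and nontriviality follows from tau 1 = 1 below. *)
HB.mixin Record isStarAlgebra (C : numClosedFieldType) A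
    of GRing.UnitAlgebra C A := {
  adj : A -> A;
  adjK : involutive adj;
  adjD : {morph adj : x y / x + y};
  adjM : forall x y, adj (x * y) = adj y * adj x;
  adjZ : forall (c : C) x, adj (c *: x) = c^* *: adj x
}.

#[short(type="starAlgType")]
HB.structure Definition StarAlgebra (C : numClosedFieldType) :=
  { A of isStarAlgebra C A & GRing.UnitAlgebra C A }.

Definition tracial_state (R : realType) (A : starAlgType (Cplx R))
    (tau : {scalar A}) : Prop :=
  [/\ tau 1 = 1,
      forall a : A, 0 <= tau (adj a * a)
    & forall a b : A, tau (a * b) = tau (b * a)].

Definition self_adjoint_projection (R : realType) (A : starAlgType (Cplx R))
    (P : A) : Prop :=
  adj P = P /\ P * P = P.

(* Meaningful only where z - a is invertible: x^-1 is x on non-units. *)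
Definition cauchy_transform (R : realType) (A : starAlgType (Cplx R))
    (tau : {scalar A}) (a : A) (z : Cplx R) : Cplx R :=
  tau ((z%:A - a)^-1).

(* K is, near y = 0, the inverse of the Cauchy transform G (which maps a
   neighbourhood of infinity to a punctured neighbourhood of 0), on the branch
   with K y ~ 1 / y. *)
Definition local_inverse_cauchy (R : realType) (A : starAlgType (Cplx R))
    (tau : {scalar A}) (a : A) (K : Cplx R -> Cplx R) : Prop :=
  [/\ \forall y \near (0 : Cplx R)^',
        (K y)%:A - a \is a GRing.unit /\ cauchy_transform tau a (K y) = y,
      exists M : R, forall z : Cplx R, toCplx M < `|z| ->
        z%:A - a \is a GRing.unit /\ K (cauchy_transform tau a z) = z
    & y * K y @[y --> (0 : Cplx R)^'] --> (1 : Cplx R)].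

(* kappa is the sequence of free cumulants of a: the R-transform K y - 1 / y
   has the expansion \sum_(n >= 0) kappa_(n+1) y ^ n around 0. The value
   kappa 0 is irrelevant. *)
Definition free_cumulants (R : realType) (A : starAlgType (Cplx R))
    (tau : {scalar A}) (a : A) (kappa : nat -> Cplx R) : Prop :=
  exists2 K : Cplx R -> Cplx R, local_inverse_cauchy tau a K &
    \forall y \near (0 : Cplx R)^',
      series (fun n => kappa n.+1 * y ^+ n) @ \oo --> K y - y^-1.

Definition pochhammer (R : realType) (a : R) (k : nat) : R :=
  \prod_(i < k) (a + i%:R).

Definition hypergeometric2F1 (R : realType) (a b c z : R) : R :=
  limn (series (fun k => pochhammer a k * pochhammer b k
                           / (pochhammer c k * k`!%:R) * z ^+ k)).

Definition legendre (R : realType) (n : nat) (x : R) : R :=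
  hypergeometric2F1 (- n%:R) (n%:R + 1) 1 ((1 - x) / 2).

(* Main.v *)
Require Import Defs.
From HB Require Import structures.
From mathcomp Require Import all_boot all_order all_algebra.
From mathcomp Require Import all_classical all_reals all_analysis.
From mathcomp.real_closed Require Import complex.
From mathcomp Require Import ring lra.

Set Implicit Arguments.
Unset Strict Implicit.
Unset Printing Implicit Defensive.

Import Order.TTheory GRing.Theory Num.Theory.
Import numFieldNormedType.Exports.

Local Open Scope classical_set_scope.
Local Open Scope ring_scope.

(* For a projection of trace alpha the Cauchy transform is
   (1 - alpha) / z + alpha / (z - 1), so y = G z says that 2 y z - (1 + y) is a
   square root of D(y) = 1 - 2 x y + y ^ 2 with x = 1 - 2 alpha; the condition
   z ~ 1 / y selects the root tending to 1, hence
   R(y) = (sqrt D(y) - 1 + y) / (2 y).  Since 1 / sqrt D generates the Legendre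
   polynomials, Bonnet's recurrence identifies the n-th Taylor coefficient of
   sqrt D = D / sqrt D with (P_(n-2) - P_n) / (2 n - 1).  This is checked by the
   differential equation 2 D S' = D' S, to which Bonnet's recurrence amounts and
   which forces S ^ 2 = D. *)

(** * The Legendre polynomials *)

Lemma pochhammerS (R : realType) (a : R) k :
  pochhammer a k.+1 = pochhammer a k * (a + k%:R).
Proof. by rewrite /pochhammer big_ord_recr. Qed.

Lemma pochhammerSl (R : realType) (a : R) k :
  pochhammer a k.+1 = a * pochhammer (a + 1) k.
Proof.
rewrite /pochhammer big_ord_recl addr0; congr (_ * _).
by apply: eq_bigr => i _; rewrite -addrA -natr1 [1 + _]addrC.
Qed.

Lemma pochhammer1 (R : realType) k : pochhammer (1 : R) k = k`!%:R.
Proof.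
elim: k => [|k IH]; first by rewrite /pochhammer big_ord0.
by rewrite pochhammerS IH factS natrM mulrC addrC natr1.
Qed.

Lemma pochhammerN_eq0 (R : realType) n k : (n < k)%N ->
  pochhammer (- n%:R : R) k = 0.
Proof.
move=> nk; rewrite /pochhammer (bigD1 (Ordinal nk)) //=.
by rewrite addNr mul0r.
Qed.

Definition legendre_coef (R : realType) (n k : nat) : R :=
  pochhammer (- n%:R) k * pochhammer (n%:R + 1) k / k`!%:R ^+ 2.

(** The hypergeometric series terminates because [pochhammer (- n%:R) k] vanishes for [k > n]. A
    free cut-off [N] lets Legendre polynomials of different degrees share one index range. *)
Lemma legendreE (R : realType) (t : R) (n N : nat) : (n < N)%N ->
  legendre n (1 - 2 * t) = \sum_(k < N) legendre_coef R n k * t ^+ k.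
Proof.
move=> nN; rewrite /legendre /hypergeometric2F1.
have -> : (1 - (1 - 2 * t)) / 2 = t by field.
have coefE k : pochhammer (- n%:R) k * pochhammer (n%:R + 1) k /
    (pochhammer 1 k * k`!%:R) * t ^+ k = legendre_coef R n k * t ^+ k.
  by rewrite pochhammer1.
apply: cvg_lim => //; apply: cvg_near_cst.
near=> m; rewrite /series /=; under eq_bigr do rewrite coefE.
have Nm : (N <= m)%N by near: m; exists N.
rewrite (big_cat_nat _ Nm) //= -(big_mkord xpredT (fun k => legendre_coef R n k * t ^+ k)).
rewrite [X in _ + X]big_nat_cond [X in _ + X]big1 ?addr0 // => i /andP[/andP[Ni _] _].
by rewrite /legendre_coef pochhammerN_eq0 ?mul0r // (leq_trans nN).
Unshelve. all: by end_near.
Qed.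

(** This is Bonnet's recurrence at the power [t ^+ k.+1], where [x = 1 - 2 * t]. *)
Lemma legendre_coef_rec (R : realType) (n k : nat) :
  (n%:R + 2) * legendre_coef R n.+2 k.+1 =
  (2 * n%:R + 3) * (legendre_coef R n.+1 k.+1 - 2 * legendre_coef R n.+1 k)
  - (n%:R + 1) * legendre_coef R n k.+1.
Proof.
have pochN m j : pochhammer (- m.+1%:R : R) j.+1 = - (m%:R + 1) * pochhammer (- m%:R) j.
  by rewrite pochhammerSl -natr1 opprD addrNK; congr (_ * _); ring.
have pochP m j : pochhammer (m%:R + 1 : R) j.+1 = (m%:R + 1) * pochhammer (m.+1%:R + 1) j.
  by rewrite pochhammerSl -natr1.
rewrite /legendre_coef; case: k => [|k].
  rewrite !pochhammerS /pochhammer !big_ord0 fact0 factS fact0 muln1 /=.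
  by rewrite -!natr1; field.
(* All Pochhammer symbols become multiples of [pochhammer (- n%:R) k] and
   [pochhammer (n.+2%:R + 1) k], which leaves a rational identity. *)
rewrite !pochN !(pochhammerS (- _)) (pochP n) !(pochP n.+1).
rewrite !(pochhammerS (n.+2%:R + 1)) !factS !natrM.
have : k`!%:R != 0 :> R by rewrite pnatr_eq0 -lt0n fact_gt0.
have : k.+1%:R != 0 :> R by rewrite pnatr_eq0.
have : k.+2%:R != 0 :> R by rewrite pnatr_eq0.
rewrite -!natr1; set N : R := n%:R; set K : R := k%:R => h1 h2 h3.
field.
by rewrite h1 h2 h3.
Qed.

Lemma legendre_bonnet (R : realType) (x : R) n :
  (n%:R + 2) * legendre n.+2 x =
  (2 * n%:R + 3) * x * legendre n.+1 x - (n%:R + 1) * legendre n x.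
Proof.
set t := (1 - x) / 2; have -> : x = 1 - 2 * t by rewrite /t; field.
have n4 : (n < n.+4)%N by do 3 apply: leqW.
rewrite (@legendreE _ _ n.+2 n.+4) // (legendreE _ n4).
have shift : (1 - 2 * t) * legendre n.+1 (1 - 2 * t) =
    legendre_coef R n.+1 0 + \sum_(k < n.+3)
      (legendre_coef R n.+1 k.+1 - 2 * legendre_coef R n.+1 k) * t ^+ k.+1.
  rewrite mulrBl mul1r {1}(@legendreE _ t n.+1 n.+4); last by do 2 apply: leqW.
  (* The copy multiplied by [t] is cut one term earlier, so that both sums end at [t ^+ n.+3]. *)
  rewrite (@legendreE _ t n.+1 n.+3) //.
  rewrite big_ord_recl expr0 mulr1 -addrA; congr (_ + _).
  rewrite -mulNr mulr_sumr -big_split /=.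
  by apply: eq_bigr => k _; rewrite exprS; ring.
rewrite -mulrA shift big_ord_recl [X in _ - (_ * X)]big_ord_recl !expr0 !mulr1.
have c0 m : legendre_coef R m 0 = 1.
  by rewrite /legendre_coef /pochhammer !big_ord0 fact0; field.
rewrite !c0 !mulrDr opprD addrACA mulr_sumr [X in _ + (X - _)]mulr_sumr.
rewrite [X in _ + (_ - X)]mulr_sumr -sumrB; congr (_ + _); first by ring.
by apply: eq_bigr => k _; rewrite mulrA legendre_coef_rec; ring.
Qed.

Lemma legendre_bonnetV (R : realType) (x : R) n :
  legendre n.+2 x =
  ((2 * n%:R + 3) * x * legendre n.+1 x - (n%:R + 1) * legendre n x) / (n%:R + 2).
Proof.
by rewrite -legendre_bonnet mulrC mulKf // -natrD pnatr_eq0 addn2.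
Qed.

Lemma legendre0 (R : realType) (x : R) : legendre 0 x = 1.
Proof.
have -> : x = 1 - 2 * ((1 - x) / 2) by field.
rewrite (@legendreE _ _ 0 1) // big_ord1 /legendre_coef /pochhammer !big_ord0 fact0.
by field.
Qed.

Lemma legendre1 (R : realType) (x : R) : legendre 1 x = x.
Proof.
have -> : x = 1 - 2 * ((1 - x) / 2) by field.
rewrite (@legendreE _ _ 1 2) // big_ord_recl big_ord1 /legendre_coef /pochhammer.
by rewrite !big_ord_recl !big_ord0 fact0 factS fact0 /=; field.
Qed.

(* The Taylor coefficients of sqrt (1 - 2 x y + y ^ 2) at y = 0. *)
Definition sqrt_coef (R : realType) (x : R) (n : nat) : R :=
  match n with
  | 0 => 1
  | 1 => - x
  | _ => (2 * n%:R - 1)^-1 * (legendre n.-2 x - legendre n x)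
  end.

(** For the generating series [S] this is the coefficient of [y ^ (n + 1)] in [D S' = (y - x) S]. *)
Lemma sqrt_coef_rec (R : realType) (x : R) n :
  (n%:R + 2) * sqrt_coef x n.+2 =
  (2 * n%:R + 1) * x * sqrt_coef x n.+1 - (n%:R - 1) * sqrt_coef x n.
Proof.
have P2 : legendre 2 x = (3 * x ^+ 2 - 1) / 2.
  by rewrite legendre_bonnetV legendre0 legendre1; field.
case: n => [|[|n]].
- by rewrite /sqrt_coef /= legendre0 P2; field.
- by rewrite /sqrt_coef /= (legendre_bonnetV x 1) P2 legendre0 legendre1; field.
rewrite /sqrt_coef /=.
have n0 : 0 <= n%:R :> R by [].
(* Only the Legendre values of degrees [n] and [n.+1] remain, and their coefficients agree as
   rational functions of [n] and [x]. *)
rewrite (legendre_bonnetV x n.+2) (legendre_bonnetV x n.+1) (legendre_bonnetV x n).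
rewrite -!natr1; set N : R := n%:R in n0 *.
field.
by rewrite -/N !lt0r_neq0 /=; lra.
Qed.

(** * The square of the truncated series *)

(** The error [V = S ^ 2 - D] satisfies [D V' - D' V = 2 S E], where [E] is the defect of [S] in the
    differential equation. Since [V] vanishes at 0 and [D] is 1 there, its coefficients vanish one
    after another as long as those of [S E] do. *)
Lemma sqrt_poly_coef (F : numFieldType) (x : F) (u : nat -> F) (N k : nat) :
  u 0 = 1 -> u 1 = - x ->
  (forall n, (n%:R + 2) * u n.+2 = (2 * n%:R + 1) * x * u n.+1 - (n%:R - 1) * u n) ->
  (k < N)%N ->
  ((\poly_(i < N) u i) ^+ 2)`_k = (1 - (2 * x) *: 'X + 'X^2 : {poly F})`_k.
Proof.
move=> u0 u1 urec.
set S := \poly_(i < N) u i; set D : {poly F} := 1 - (2 * x) *: 'X + 'X^2.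
pose E := D * S^`() - ('X - x%:P) * S.
pose V := S ^+ 2 - D.
have DE p : D * p = p - (2 * x) *: ('X * p) + 'X^2 * p.
  by rewrite /D mulrDl mulrBl mul1r scalerAl.
have dD : D^`() = 2 *: ('X - x%:P).
  rewrite /D derivD derivB derivZ derivX derivXn derivC add0r /= scalerBr scaler_nat addrC.
  by rewrite -!mul_polyC mulr1 polyCM.
have odeV : D * V^`() - D^`() * V = 2 *: (S * E).
  rewrite /E /V derivB expr2 derivM dD -!mul_polyC.
  have -> : (2%:P : {poly F}) = 2 by rewrite polyC_natr.
  ring.
have Elow j : (j.+1 < N)%N -> E`_j = 0.
  move=> jN; rewrite /E DE mulrBl mul_polyC !(coefB, coefD, coefZ, coefXM, coefXnM).
  rewrite !coef_deriv !coef_poly jN (ltnW jN).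
  case: j jN => [|[|j]] jN /=.
  - by rewrite u0 u1; ring.
  - rewrite (ltnW jN) (ltnW (ltnW jN)) u0 u1 -(mulr_natr (u 2)) mulr1n.
    have := urec 0; rewrite u0 u1 mulr0n add0r mulrC => ->; ring.
  rewrite !subSS subn0 (ltnW jN) (ltnW (ltnW jN)) -!(mulr_natr (u _)).
  have := urec j.+1; rewrite -(natr1 j.+2) -(natr1 j.+1) -(natr1 j) => e.
  by rewrite -[RHS](subrr ((j%:R + 1 + 2) * u j.+3)) {2}e; ring.
have SElow j : (j.+1 < N)%N -> (S * E)`_j = 0.
  move=> jN; rewrite coefM big1 // => i _; rewrite Elow ?mulr0 //.
  by rewrite (leq_ltn_trans _ jN) // ltnS leq_subr.
suff Vlow j : (j < N)%N -> V`_j = 0.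
  by move=> kN; apply/eqP; rewrite -subr_eq0 -coefB; apply/eqP/Vlow.
have V0 : (0 < N)%N -> V`_0 = 0.
  move=> N0; rewrite /V /D expr2 coefB coefM big_ord1 !(coefB, coefD, coefZ, coefX, coefXn, coef1).
  by rewrite coef_poly N0 u0 /=; ring.
clearbody V.
elim/ltn_ind: j => -[|j] IH jN; first exact: V0.
(* Coefficient [j] of the equation is [j.+1] times coefficient [j.+1] of [V], plus a combination of
   lower coefficients, all zero by induction. *)
have := congr1 (fun p : {poly F} => p`_j) odeV.
rewrite DE dD -scalerAl mulrBl mul_polyC !(coefB, coefD, coefZ, coefXM, coefXnM).
rewrite SElow // !coef_deriv mulr0.
have {V0 jN}IH i : (i <= j)%N -> V`_i = 0.
  by move=> ij; apply: IH => //; apply: leq_ltn_trans jN; apply: leqW.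
have -> : (if (j < 2)%N then 0 else V`_(j - 2).+1 *+ (j - 2).+1) = 0 :> F.
  by case: ltnP => // j2; rewrite IH ?mul0rn // -subSn // leq_subLR add2n; apply: leqW.
have -> : (if j == 0 then 0 else V`_j.-1) = 0 :> F.
  by case: eqP => // _; rewrite IH // leq_pred.
have -> : (if j == 0 then 0 else V`_j.-1.+1 *+ j.-1.+1) = 0 :> F.
  by case: j IH => //= j IH; rewrite IH ?mul0rn.
rewrite (IH j) // !(mulr0, subr0, addr0) => /eqP; rewrite mulrn_eq0 /= => /eqP //.
Qed.

(** * The real-valued complex modulus *)

HB.instance Definition _ (R : realType) :=
  GRing.RMorphism.copy (@toCplx R) (real_complex R).

Lemma toCplxI (R : realType) : injective (@toCplx R).
Proof. by move=> x y []. Qed.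

(* The norm of Cplx R takes its values in Cplx R, which is only partially
   ordered; estimates are carried out in R instead. *)
Definition rnorm (R : realType) (z : Cplx R) : R := complex.Re `|z|.

Lemma toCplx_rnorm (R : realType) (z : Cplx R) : toCplx (rnorm z) = `|z|.
Proof. exact: RRe_real (normr_real z). Qed.

Lemma toCplx_le (R : realType) (a b : R) : (toCplx a <= toCplx b) = (a <= b).
Proof. exact: lecR. Qed.

Lemma toCplx_lt (R : realType) (a b : R) : (toCplx a < toCplx b) = (a < b).
Proof. exact: ltcR. Qed.

Lemma rnormM (R : realType) (y z : Cplx R) : rnorm (y * z) = rnorm y * rnorm z.
Proof. by apply: toCplxI; rewrite rmorphM !toCplx_rnorm normrM. Qed.

Lemma rnormN (R : realType) (z : Cplx R) : rnorm (- z) = rnorm z.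
Proof. by rewrite /rnorm normrN. Qed.

Lemma rnorm_distC (R : realType) (y z : Cplx R) : rnorm (y - z) = rnorm (z - y).
Proof. by rewrite /rnorm distrC. Qed.

Lemma rnormD (R : realType) (y z : Cplx R) : rnorm (y + z) <= rnorm y + rnorm z.
Proof. by rewrite -toCplx_le rmorphD !toCplx_rnorm ler_normD. Qed.

Lemma rnormB (R : realType) (y z : Cplx R) : rnorm (y - z) <= rnorm y + rnorm z.
Proof. by rewrite -(rnormN z) rnormD. Qed.

Lemma rnormV (R : realType) (z : Cplx R) : rnorm z^-1 = (rnorm z)^-1.
Proof. by apply: toCplxI; rewrite fmorphV !toCplx_rnorm normfV. Qed.

Lemma rnormX (R : realType) (z : Cplx R) n : rnorm (z ^+ n) = rnorm z ^+ n.
Proof. by apply: toCplxI; rewrite rmorphXn !toCplx_rnorm normrX. Qed.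

Lemma rnorm_toCplx (R : realType) (a : R) : rnorm (toCplx a) = `|a|.
Proof. by rewrite /rnorm normc_def /= expr0n addr0 sqrtr_sqr. Qed.

Lemma rnorm_nat (R : realType) n : rnorm (n%:R : Cplx R) = n%:R.
Proof. by rewrite -(rmorph_nat (@toCplx R)) rnorm_toCplx normr_nat. Qed.

Lemma rnorm1 (R : realType) : rnorm (1 : Cplx R) = 1.
Proof. exact: (rnorm_nat R 1). Qed.

Lemma rnorm_ge0 (R : realType) (z : Cplx R) : 0 <= rnorm z.
Proof. by rewrite -toCplx_le rmorph0 toCplx_rnorm. Qed.

Lemma rnorm_eq0 (R : realType) (z : Cplx R) : (rnorm z == 0) = (z == 0).
Proof. by rewrite -(inj_eq (@toCplxI R)) rmorph0 toCplx_rnorm normr_eq0. Qed.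

Lemma rnorm_gt0 (R : realType) (z : Cplx R) : (0 < rnorm z) = (z != 0).
Proof. by rewrite lt_neqAle rnorm_ge0 andbT eq_sym rnorm_eq0. Qed.

Lemma rnorm_sum (R : realType) (I : Type) (r : seq I) (p : pred I) (f : I -> Cplx R) :
  rnorm (\sum_(i <- r | p i) f i) <= \sum_(i <- r | p i) rnorm (f i).
Proof.
rewrite -toCplx_le rmorph_sum toCplx_rnorm; apply: le_trans (ler_norm_sum _ _ _) _.
by rewrite ler_sum // => i _; rewrite toCplx_rnorm.
Qed.

Lemma gt0_toCplxP (R : realType) (e : Cplx R) : 0 < e -> exists2 d : R, 0 < d & e = toCplx d.
Proof.
move=> e0; exists (complex.Re e); last by rewrite /toCplx RRe_real // gtr0_real.
by rewrite -toCplx_lt rmorph0 /toCplx RRe_real // gtr0_real.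
Qed.

Lemma near_dnbhs0P (R : realType) (Q : Cplx R -> Prop) :
  (\forall y \near (0 : Cplx R)^', Q y) <->
  exists2 d : R, 0 < d & forall y, y != 0 -> rnorm y < d -> Q y.
Proof.
rewrite /dnbhs near_withinE; split.
  move=> /nbhs_normP[e /= /gt0_toCplxP[d d0 ->] Qd]; exists d => // y y0 yd.
  by apply: Qd => //=; rewrite add0r normrN -toCplx_rnorm toCplx_lt.
move=> [d d0 Qd]; apply/nbhs_normP; exists (toCplx d) => /=.
  by rewrite -(rmorph0 (@toCplx R)) toCplx_lt.
move=> y /=; rewrite add0r normrN -toCplx_rnorm toCplx_lt => yd y0.
exact: Qd.
Qed.

Lemma cvg_rnormP (R : realType) (u : nat -> Cplx R) (l : Cplx R) :
  u @ \oo --> l <->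
  forall e : R, 0 < e -> exists N, forall n, (N <= n)%N -> rnorm (l - u n) < e.
Proof.
split=> [/cvgrPdist_lt ul e e0|ul].
  have /ul[N _ Nu] : 0 < toCplx e by rewrite -(rmorph0 (@toCplx R)) toCplx_lt.
  by exists N => n /Nu /=; rewrite -toCplx_rnorm toCplx_lt.
apply/cvgrPdist_lt => _ /gt0_toCplxP[e e0 ->].
have [N Nu] := ul e e0; exists N => // n /= /Nu.
by rewrite -toCplx_rnorm toCplx_lt.
Qed.

Lemma cvg_of_geometric (R : realType) (u : nat -> Cplx R) (l : Cplx R) (c : R) N :
  (forall n, (N <= n)%N -> rnorm (l - u n) <= c * 2^-1 ^+ n) -> u @ \oo --> l.
Proof.
move=> ul; apply/cvg_rnormP => e e0.
have := @cvg_geometric R c 2^-1; rewrite gtr0_norm ?invr_gt0 // invf_lt1 // ltr1n => /(_ erefl).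
move=> /cvgrPdist_lt /(_ e e0) [M _ Mu].
exists (maxn N M) => n; rewrite geq_max => /andP[/ul un /Mu /=].
rewrite /geometric /= sub0r normrN => /ltr_normlW; exact: le_lt_trans.
Qed.

(** * Convergence to the square root of the discriminant *)

(** The recurrence has two terms, so two consecutive bounds are carried along; the step needs
    [3 (2 n + 1) + (n + 1) <= 9 (n + 2)]. *)
Lemma sqrt_coef_bound (R : realType) (x : R) n : `|x| <= 1 -> `|sqrt_coef x n| <= 3 ^+ n.
Proof.
move=> x1; suff [] : `|sqrt_coef x n| <= 3 ^+ n /\ `|sqrt_coef x n.+1| <= 3 ^+ n.+1 by [].
elim: n => [|n [IH0 IH1]].
  by rewrite /= expr0 expr1 normr1 normrN; split => //; apply: le_trans x1 _; lra.
split => //; have n0 : 0 <= n%:R :> R by [].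
have n2 : 0 < n%:R + 2 :> R by lra.
rewrite -(ler_pM2l n2) -{1}(gtr0_norm n2) -normrM sqrt_coef_rec.
apply: le_trans (ler_normB _ _) _; rewrite !normrM.
have -> : `|2 * n%:R + 1| = 2 * n%:R + 1 :> R by apply: ger0_norm; lra.
have : `|n%:R - 1| <= n%:R + 1 :> R by rewrite ler_norml; lra.
have : `|x| * `|sqrt_coef x n.+1| <= 3 ^+ n.+1.
  by rewrite -[leRHS]mul1r ler_pM.
move: (normr_ge0 (sqrt_coef x n)) IH0; rewrite !exprS -mulrA.
set a := `|sqrt_coef x n|; set b := `|x| * _; set c := `|_ - 1|; set t := 3 ^+ n.
have t0 : 0 <= t by rewrite exprn_ge0.
move: (normr_ge0 (n%:R - 1 : R)); rewrite -/c; move: n0; set m : R := n%:R.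
move=> m0 c0 a0 at_ bt cm.
have h1 : c * a <= (m + 1) * t by rewrite ler_pM.
have h2 : (2 * m + 1) * b <= (2 * m + 1) * (3 * t) by rewrite ler_wpM2l //; lra.
have h3 : 0 <= m * t by rewrite mulr_ge0.
nra.
Qed.

Lemma sum_geometric_half (R : realType) n : \sum_(k < n) (2^-1 : R) ^+ k <= 2.
Proof.
suff -> : \sum_(k < n) (2^-1 : R) ^+ k = 2 - 2 * 2^-1 ^+ n.
  by rewrite gerBl mulr_ge0 // exprn_ge0 // invr_ge0.
elim: n => [|n IH]; first by rewrite big_ord0 expr0; ring.
by rewrite big_ord_recr /= IH exprS; field.
Qed.

(** The radius is 1/24 so that term [k] is at most [(6 / 24) ^ k], the square of [2^-1 ^+ k]: one
    factor gives the decay in [N], the other sums to at most 2. *)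
Lemma rnorm_horner_tail (R : realType) (q : {poly R}) (y : Cplx R) N :
  (forall k, (k < N)%N -> q`_k = 0) -> (forall k, `|q`_k| <= 6 ^+ k) ->
  rnorm y <= 24^-1 ->
  rnorm (map_poly (@toCplx R) q).[y] <= 2 * 2^-1 ^+ N.
Proof.
move=> qlow qbnd yle; rewrite horner_coef.
apply: le_trans (rnorm_sum _ _ _) _.
have half0 : 0 <= 2^-1 :> R by [].
apply: (@le_trans _ _ (\sum_(k < size (map_poly (@toCplx R) q)) 2^-1 ^+ k * 2^-1 ^+ N)).
  apply: ler_sum => k _; rewrite coef_map /= rnormM rnorm_toCplx rnormX.
  case: (ltnP k N) => kN; first by rewrite qlow // normr0 mul0r mulr_ge0 ?exprn_ge0.
  apply: (@le_trans _ _ (6 ^+ k * 24^-1 ^+ k)).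
    by rewrite ler_pM ?exprn_ge0 ?rnorm_ge0 ?lerXn2r ?nnegrE ?rnorm_ge0.
  have -> : 6 ^+ k * 24^-1 ^+ k = 2^-1 ^+ k * 2^-1 ^+ k :> R.
    by rewrite -!exprMn; congr (_ ^+ _); field.
  rewrite ler_wpM2l ?exprn_ge0 // ler_wiXn2l //.
  by rewrite invf_le1 // ler1n.
by rewrite -mulr_suml ler_wpM2r ?exprn_ge0 ?sum_geometric_half.
Qed.

(** The convolution has [k.+1 <= 2 ^ k] terms, each at most [3 ^+ k]. *)
Lemma coef_sqr_bound (R : realType) (p : {poly R}) k :
  (forall i, `|p`_i| <= 3 ^+ i) -> `|(p ^+ 2)`_k| <= 6 ^+ k.
Proof.
move=> pbnd; rewrite expr2 coefM; apply: le_trans (ler_norm_sum _ _ _) _.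
apply: (@le_trans _ _ (\sum_(i < k.+1) 3 ^+ k)).
  apply: ler_sum => i _; rewrite normrM -{4}(subnKC (leq_ord i)) exprD.
  by rewrite ler_pM.
rewrite sumr_const card_ord -[leLHS]mulr_natl.
have -> : 6 ^+ k = 2 ^+ k * 3 ^+ k :> R by rewrite -exprMn; congr (_ ^+ _); ring.
by rewrite ler_wpM2r ?exprn_ge0 // -natrX ler_nat ltn_expl.
Qed.

Definition sqrt_series (R : realType) (x : R) (y : Cplx R) : nat -> Cplx R :=
  series (fun n => toCplx (sqrt_coef x n) * y ^+ n).

Definition disc (R : realType) (x : R) (y : Cplx R) : Cplx R :=
  1 - 2 * toCplx x * y + y ^+ 2.

Lemma sqrt_series_sqr (R : realType) (x : R) (y : Cplx R) N :
  `|x| <= 1 -> rnorm y <= 24^-1 -> (3 <= N)%N ->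
  rnorm (sqrt_series x y N ^+ 2 - disc x y) <= 2 * 2^-1 ^+ N.
Proof.
move=> x1 y24 N3.
pose S := \poly_(i < N) sqrt_coef x i.
pose D : {poly R} := 1 - (2 * x) *: 'X + 'X^2.
have Sbnd i : `|S`_i| <= 3 ^+ i.
  by rewrite coef_poly; case: ifP => _; rewrite ?normr0 ?exprn_ge0 ?sqrt_coef_bound.
have low k : (k < N)%N -> (S ^+ 2 - D)`_k = 0.
  move=> kN; rewrite coefB (@sqrt_poly_coef _ x (sqrt_coef x)) ?subrr //.
  exact: sqrt_coef_rec.
have bnd k : `|(S ^+ 2 - D)`_k| <= 6 ^+ k.
  case: (ltnP k N) => kN; first by rewrite low // normr0 exprn_ge0.
  (* [D] has degree at most 2, so [3 <= N] keeps it out of these coefficients. *)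
  have -> : (S ^+ 2 - D)`_k = (S ^+ 2)`_k; last exact: coef_sqr_bound.
  rewrite coefB /D !(coefB, coefD, coefZ, coefX, coefXn, coef1).
  by case: k kN => [|[|[|k]]] kN /=; [| | | ring]; move: (leq_trans N3 kN).
have := rnorm_horner_tail low bnd y24.
congr (rnorm _ <= _).
rewrite rmorphB rmorphXn /= hornerD hornerN horner_exp; congr (_ ^+ 2 - _).
  have -> : map_poly (@toCplx R) S = \poly_(i < N) toCplx (sqrt_coef x i).
    by apply/polyP => i; rewrite coef_map !coef_poly; case: ifP; rewrite ?rmorph0.
  by rewrite horner_poly /sqrt_series /series /= big_mkord.
rewrite /D rmorphD rmorphB rmorph1 /= map_polyZ map_polyX map_polyXn.
by rewrite !hornerE rmorphM rmorph_nat.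
Qed.

(** Term [k.+1] is at most [(3 / 24) ^ (k + 1)], hence at most [4^-1 * 2^-1 ^+ k]. This keeps the
    partial sums away from the root of [D] near -1. *)
Lemma sqrt_series_near1 (R : realType) (x : R) (y : Cplx R) N :
  `|x| <= 1 -> rnorm y <= 24^-1 -> (0 < N)%N ->
  rnorm (sqrt_series x y N - 1) <= 2^-1.
Proof.
move=> x1 y24; case: N => // N _.
have := fun n => sqrt_coef_bound n x1; rewrite /sqrt_series /series /= big_mkord big_ord_recl.
have : sqrt_coef x 0 = 1 by []; move: (sqrt_coef x) => u -> ubnd.
rewrite rmorph1 expr0 mulr1 addrAC subrr add0r.
apply: le_trans (rnorm_sum _ _ _) _.
apply: (@le_trans _ _ (\sum_(k < N) 4^-1 * 2^-1 ^+ k)); last first.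
  by rewrite -mulr_sumr; have := sum_geometric_half R N; lra.
apply: ler_sum => k _; rewrite rnormM rnorm_toCplx rnormX lift0.
apply: (@le_trans _ _ (3 ^+ k.+1 * 24^-1 ^+ k.+1)).
  by rewrite ler_pM ?exprn_ge0 ?rnorm_ge0 ?lerXn2r ?nnegrE ?rnorm_ge0.
rewrite -exprMn exprS ler_pM ?exprn_ge0 ?lerXn2r ?nnegrE //; lra.
Qed.

(** In [(S - s) (S + s) = S ^ 2 - D] the second factor has modulus at least
    [|1 + s| - |S - 1| >= 1/2], so dividing by it at most doubles the error. *)
Lemma sqrt_series_approx (R : realType) (x : R) (y s : Cplx R) N :
  `|x| <= 1 -> rnorm y <= 24^-1 -> s ^+ 2 = disc x y -> 1 <= rnorm (1 + s) ->
  (3 <= N)%N -> rnorm (s - sqrt_series x y N) <= 4 * 2^-1 ^+ N.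
Proof.
move=> x1 y24 sD s1 N3.
have := sqrt_series_sqr x1 y24 N3.
have := sqrt_series_near1 x1 y24 (leq_trans _ N3 : (0 < N)%N).
set S := sqrt_series x y N => /(_ isT) S1.
rewrite -sD subr_sqr rnormM => S2.
have : rnorm (1 + s) <= rnorm (S + s) + rnorm (S - 1).
  by rewrite (_ : 1 + s = S + s - (S - 1)) ?rnormB //; ring.
rewrite rnorm_distC; move: (rnorm_ge0 (S - s)) => h0 h1.
have : 2^-1 <= rnorm (S + s) by lra.
nra.
Qed.

(* The square root of D nearer to 1. *)
Definition sqrt_branch (R : realType) (D : Cplx R) : Cplx R :=
  if 1 <= rnorm (1 + sqrtC D) then sqrtC D else - sqrtC D.

Lemma sqrt_branchK (R : realType) (D : Cplx R) : sqrt_branch D ^+ 2 = D.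
Proof. by rewrite /sqrt_branch; case: ifP => _; rewrite ?sqrrN sqrtCK. Qed.

(** The numbers [1 + r] and [1 - r] add up to 2, so they cannot both have modulus below 1. *)
Lemma rnorm_1_sqrt_branch (R : realType) (D : Cplx R) : 1 <= rnorm (1 + sqrt_branch D).
Proof.
rewrite /sqrt_branch; case: (leP 1 (rnorm (1 + sqrtC D))) => //= lt1.
have := rnormD (1 + sqrtC D) (1 - sqrtC D).
rewrite (_ : _ + _ + _ = 2%:R) ?rnorm_nat; [lra | ring].
Qed.

(** The opposite root is at distance [rnorm (1 + sqrt_branch D) >= 1] from 1. *)
Lemma sqrt_branch_unique (R : realType) (D s : Cplx R) :
  s ^+ 2 = D -> rnorm (s - 1) < 1 -> s = sqrt_branch D.
Proof.
move=> sD s1; have /eqP : s ^+ 2 = sqrt_branch D ^+ 2 by rewrite sD sqrt_branchK.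
rewrite eqf_sqr => /orP[/eqP //|/eqP sE].
have := rnorm_1_sqrt_branch D; rewrite -rnormN opprD addrC -sE => h.
by have := le_lt_trans h s1; rewrite ltxx.
Qed.

(** With [s] the branch, [(1 - s) (1 + s) = 1 - D = y (2 x - y)], and [1 + s] has modulus at least
    1. *)
Lemma sqrt_branch_disc_near1 (R : realType) (x : R) (y : Cplx R) :
  `|x| <= 1 -> rnorm y <= 1 -> rnorm (1 - sqrt_branch (disc x y)) <= 3 * rnorm y.
Proof.
move=> x1 y1; have s1 := rnorm_1_sqrt_branch (disc x y).
have := congr1 (@rnorm R) (sqrt_branchK (disc x y)).
set s := sqrt_branch _ in s1 *.
have e : (1 - s) * (1 + s) = y * (2 * toCplx x - y).
  by rewrite -subr_sqr expr1n /s sqrt_branchK /disc; ring.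
have := congr1 (@rnorm R) e; rewrite !rnormM => {}e _.
have h : rnorm (2 * toCplx x - y) <= 3.
  apply: le_trans (rnormB _ _) _; rewrite rnormM (rnorm_nat R 2) rnorm_toCplx; lra.
move: (rnorm_ge0 (1 - s)) (rnorm_ge0 y) => h1 h2.
nra.
Qed.

Definition cauchy_inverse (R : realType) (x : R) (y : Cplx R) : Cplx R :=
  (1 + y + sqrt_branch (disc x y)) / (2 * y).

(** * The R-transform as a power series *)

(** The coefficient of [y ^ n] in [(sqrt D + y) / 2]; for positive [n] it is that of [y ^ (n - 1)]
    in the R-transform. *)
Definition projection_cumulant (R : realType) (x : R) (n : nat) : R :=
  (sqrt_coef x n + (n == 1%N)%:R) / 2.

Lemma sqrt_series_cumulants (R : realType) (x : R) (y : Cplx R) N :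
  sqrt_series x y N.+2 =
  1 - y + 2 * y * series (fun n => toCplx (projection_cumulant x n.+1) * y ^+ n) N.+1.
Proof.
have two : toCplx 2 = 2 :> Cplx R by rewrite rmorph_nat.
have cE n : toCplx (sqrt_coef x n) = 2 * toCplx (projection_cumulant x n) - (n == 1%N)%:R.
  rewrite -two -(rmorph_nat (@toCplx R)) -rmorphM -rmorphB /projection_cumulant.
  by congr toCplx; field.
elim: N => [|N IH].
  rewrite /sqrt_series /series /= !big_nat_recr //= !big_geq // !add0r !expr0 expr1 !mulr1.
  by rewrite rmorph1 (cE 1%N) /=; ring.
rewrite /sqrt_series /series /= big_nat_recr //= [in RHS]big_nat_recr //=.
move: IH; rewrite /sqrt_series /series /= => ->; rewrite (cE N.+2) /= exprS; ring.
Qed.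

Lemma r_transform_cvg (R : realType) (x : R) (y : Cplx R) :
  `|x| <= 1 -> y != 0 -> rnorm y <= 24^-1 ->
  series (fun n => toCplx (projection_cumulant x n.+1) * y ^+ n) @ \oo -->
    cauchy_inverse x y - y^-1.
Proof.
move=> x1 y0 y24; apply: (@cvg_of_geometric _ _ _ (rnorm y)^-1 2) => -[//|n] n2.
have yp : 0 < rnorm y by rewrite rnorm_gt0.
(* Here [n2 : 2 <= n.+1] serves as [3 <= n.+2]: division by [y] shifts the partial sums by one. *)
have := @sqrt_series_approx _ x y _ n.+2 x1 y24 (sqrt_branchK _) (rnorm_1_sqrt_branch _) n2.
rewrite sqrt_series_cumulants /cauchy_inverse.
set s := sqrt_branch _; set T := series _ _ => h.
rewrite ler_pdivlMl // -rnormM.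
suff -> : y * ((1 + y + s) / (2 * y) - y^-1 - T) = 2^-1 * (s - (1 - y + 2 * y * T)).
  rewrite rnormM rnormV (rnorm_nat R 2); move: h; rewrite exprS.
  by lra.
by field.
Qed.

(** If [c m] is the first nonzero coefficient, its term is of order [t ^ m] at radius [t * r], while
    the later terms and the partial sum can be made of order [t ^ (m + 1)]; small [t] gives a
    contradiction. *)
Lemma power_series_eq0 (R : realType) (c : nat -> Cplx R) (d : R) :
  0 < d ->
  (forall y, y != 0 -> rnorm y < d -> series (fun n => c n * y ^+ n) @ \oo --> (0 : Cplx R)) ->
  forall n, c n = 0.
Proof.
move=> d0 c0; pose r := d / 2.
have r0 : 0 < r by rewrite divr_gt0.
have [B B0 Bc] : exists2 B : R, 0 <= B & forall n, rnorm (c n) * r ^+ n <= B.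
  have rE : rnorm (toCplx r) = r by rewrite rnorm_toCplx gtr0_norm.
  have /cvg_rnormP /(_ 2^-1) : series (fun n => c n * toCplx r ^+ n) @ \oo --> (0 : Cplx R).
    by apply: c0; rewrite -?rnorm_gt0 ?rE // /r; lra.
  case=> [//|N hN].
  exists (1 + \sum_(k < N) rnorm (c k) * r ^+ k).
    by rewrite addr_ge0 // sumr_ge0 // => i _; rewrite mulr_ge0 ?rnorm_ge0 ?exprn_ge0 // ltW.
  have t0 k : 0 <= rnorm (c k) * r ^+ k by rewrite mulr_ge0 ?rnorm_ge0 ?exprn_ge0 // ltW.
  (* An early term is one summand of the bound; a late one is the difference of two partial sums of
     modulus below 1/2. *)
  move=> n; case: (ltnP n N) => nN.
    rewrite (bigD1 (Ordinal nN)) //= addrCA lerDl addr_ge0 // sumr_ge0 //.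
  have := hN n nN; have := hN n.+1 (leqW nN); rewrite !sub0r !rnormN => h1 h2.
  have -> : rnorm (c n) * r ^+ n = rnorm (c n * toCplx r ^+ n) by rewrite rnormM rnormX rE.
  have -> : c n * toCplx r ^+ n = series (fun n => c n * toCplx r ^+ n) n.+1
                                 - series (fun n => c n * toCplx r ^+ n) n.
    by rewrite /series /= big_nat_recr //= addrAC subrr add0r.
  apply: le_trans (rnormB _ _) _.
  have : 0 <= \sum_(k < N) rnorm (c k) * r ^+ k by rewrite sumr_ge0.
  lra.
elim/ltn_ind => m IH; apply/eqP; rewrite -rnorm_eq0; apply: contraT => cm.
pose a := rnorm (c m) * r ^+ m.
have a0 : 0 < a by rewrite mulr_gt0 ?exprn_gt0 // lt_neqAle eq_sym cm rnorm_ge0.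
(* The bound 1/2 makes the tail sum at most [2 * B * t ^+ m.+1]; the other makes [(2 * B + 1) * t]
   less than [a]. *)
pose t := Num.min 2^-1 (a / (2 * (2 * B + 1))).
have t0 : 0 < t by rewrite lt_min invr_gt0 ltr0n /= divr_gt0 //; lra.
have t2 : t <= 2^-1 by rewrite ge_min lexx.
have ta : (2 * B + 1) * t < a.
  apply: (@le_lt_trans _ _ (a / 2)); last by lra.
  have : t <= a / (2 * (2 * B + 1)) by rewrite ge_min lexx orbT.
  move=> /(ler_wpM2l (_ : 0 <= 2 * B + 1)) h; apply: le_trans (h _) _; first by lra.
  by rewrite le_eqVlt; apply/orP; left; apply/eqP; field; rewrite lt0r_neq0; lra.
have yE : rnorm (toCplx (t * r)) = t * r by rewrite rnorm_toCplx gtr0_norm // mulr_gt0.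
have /cvg_rnormP /(_ (t ^+ m.+1)) :
    series (fun n => c n * toCplx (t * r) ^+ n) @ \oo --> (0 : Cplx R).
  apply: c0; rewrite -?rnorm_gt0 yE ?mulr_gt0 //.
  by rewrite /r; nra.
case=> [|N /(_ (maxn N m.+1) (leq_maxl _ _))]; first exact: exprn_gt0.
(* The index must exceed [m] for the partial sum to contain the leading term. *)
set n := maxn N m.+1; have mn : (m.+1 <= n)%N by rewrite leq_maxr.
rewrite sub0r rnormN /series /= (big_cat_nat (leq0n m) (ltnW mn)) /=.
rewrite [X in X + _]big_nat_cond [X in X + _]big1 ?add0r; last first.
  by move=> i /andP[/andP[_ im] _]; rewrite IH // mul0r.
rewrite big_ltn // -{1}[m.+1]add0n big_addn big_mkord.
set y := toCplx (t * r) in yE *; set T := \sum_(i < _) _ => h.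
have Tb : rnorm T <= 2 * B * t ^+ m.+1.
  apply: le_trans (rnorm_sum _ _ _) _.
  apply: (@le_trans _ _ (\sum_(i < n - m.+1) (B * t ^+ m.+1) * 2^-1 ^+ i)).
    apply: ler_sum => i _; rewrite rnormM rnormX yE exprMn [t ^+ _ * _]mulrC mulrA.
    rewrite -[leRHS]mulrA ler_pM ?mulr_ge0 ?rnorm_ge0 ?exprn_ge0 ?(ltW r0) ?(ltW t0) //.
    by rewrite exprD mulrC ler_wpM2l ?exprn_ge0 ?lerXn2r ?nnegrE ?(ltW t0).
  rewrite -mulr_sumr; have := sum_geometric_half R (n - m.+1).
  have : 0 <= B * t ^+ m.+1 by rewrite mulr_ge0 // exprn_ge0 // ltW.
  nra.
have : rnorm (c m * y ^+ m) <= rnorm (c m * y ^+ m + T) + rnorm T.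
  by apply: le_trans (rnormB _ _); rewrite addrK.
have -> : rnorm (c m * y ^+ m) = a * t ^+ m by rewrite rnormM rnormX yE exprMn /a; ring.
move: h Tb; rewrite exprS => h Tb h3.
have : a * t ^+ m < (2 * B + 1) * t * t ^+ m by lra.
by rewrite ltr_pM2r ?exprn_gt0 // ltNge (ltW ta).
Qed.

(** * The Cauchy transform of a projection *)

(** [P] and [1 - P] are orthogonal idempotents with sum 1, so [z - P = z (1 - P) + (z - 1) P] is
    inverted componentwise. *)
Lemma resolvent_idempotent (F : fieldType) (A : unitAlgType F) (P : A) (z : F) :
  P * P = P -> z != 0 -> z != 1 ->
  z%:A - P \is a GRing.unit /\
  (z%:A - P)^-1 = z^-1 *: (1 - P) + (z - 1)^-1 *: P.
Proof.
move=> PP z0 z1; have zm : z - 1 != 0 by rewrite subr_eq0.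
set Q : A := z^-1 *: _ + _.
have zE : z%:A - P = z *: (1 - P) + (z - 1) *: P.
  by rewrite scalerBr scalerBl scale1r addrA subrK.
have PQ : P * (1 - P) = 0 by rewrite mulrBr mulr1 PP subrr.
have QP : (1 - P) * P = 0 by rewrite mulrBl mul1r PP subrr.
have QQ : (1 - P) * (1 - P) = 1 - P by rewrite mulrBr mulr1 QP subr0.
have inv (a b c d : F) : a * c = 1 -> b * d = 1 ->
    (a *: (1 - P) + b *: P) * (c *: (1 - P) + d *: P) = 1.
  move=> ac bd; rewrite mulrDl !mulrDr -!scalerAl -!scalerAr PQ QP QQ PP !scalerA ac bd.
  by rewrite !scaler0 addr0 add0r !scale1r subrK.
have RQ : (z%:A - P) * Q = 1 by rewrite zE /Q inv ?divff.
have QR : Q * (z%:A - P) = 1 by rewrite zE /Q inv ?mulVf.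
have U : z%:A - P \is a GRing.unit by apply/unitrP; exists Q.
by split=> //; apply: (mulrI U); rewrite RQ divrr.
Qed.

Lemma cauchy_transform_projection (R : realType) (A : starAlgType (Cplx R))
    (tau : {scalar A}) (P : A) (z : Cplx R) :
  tau 1 = 1 -> P * P = P -> z != 0 -> z != 1 ->
  cauchy_transform tau P z = (1 - tau P) / z + tau P / (z - 1).
Proof.
move=> tau1 PP z0 z1; rewrite /cauchy_transform (resolvent_idempotent PP z0 z1).2.
by rewrite linearD !linearZ linearB /= tau1 ![_^-1 * _]mulrC.
Qed.

(** Both [P] and [1 - P] have the form [adj a * a], on which [tau] is nonnegative. *)
Lemma tracial_state_projection_bounds (R : realType) (A : starAlgType (Cplx R))
    (tau : {scalar A}) (P : A) (alpha : R) :
  tracial_state tau -> self_adjoint_projection P -> tau P = toCplx alpha ->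
  0 <= alpha <= 1.
Proof.
move=> [tau1 tau0 _] [adjP PP] tauP.
have adj1 : adj (1 : A) = 1.
  by have := adjM (adj (1 : A)) 1; rewrite mulr1 adjK mulr1 => <-.
have adjN (a : A) : adj (- a) = - adj a.
  (* Unqualified, adjZ is the lemma on adjugate matrices. *)
  by rewrite -(scaleN1r a) Defs.adjZ rmorphN1 scaleN1r.
rewrite -!(toCplx_le) rmorph0 rmorph1 -tauP; apply/andP; split.
  by rewrite -{1}PP -{1}adjP tau0.
rewrite -subr_ge0 -tau1 -linearB /=.
have := tau0 (1 - P); rewrite adjD adjN adj1 adjP mulrBr mulr1 mulrBl mul1r PP.
by rewrite subrr subr0.
Qed.

Lemma cauchy_discriminant (R : realType) (alpha : R) (y z : Cplx R) :
  z != 0 -> z != 1 -> y != 0 ->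
  (1 - toCplx alpha) / z + toCplx alpha / (z - 1) = y <->
  (2 * y * z - (1 + y)) ^+ 2 = disc (1 - 2 * alpha) y.
Proof.
move=> z0 z1 y0; have zm : z - 1 != 0 by rewrite subr_eq0.
set a := toCplx alpha.
have discE : (2 * y * z - (1 + y)) ^+ 2 - disc (1 - 2 * alpha) y =
    4 * y * (z * (z - 1)) * (y - ((1 - a) / z + a / (z - 1))).
  rewrite /disc rmorphB rmorph1 rmorphM (rmorph_nat _ 2) -/a; field.
  by rewrite zm z0.
split=> [e|/eqP].
  by apply/eqP; rewrite -subr_eq0 discE e subrr mulr0.
rewrite -subr_eq0 discE !mulf_eq0 (negPf y0) (negPf z0) (negPf zm) /= (pnatr_eq0 _ 4) /=.
by rewrite subr_eq0 => /eqP.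
Qed.

Lemma cauchy_inverse_local_inverse (R : realType) (A : starAlgType (Cplx R))
    (tau : {scalar A}) (P : A) (alpha : R) :
  tau 1 = 1 -> P * P = P -> tau P = toCplx alpha -> 0 <= alpha <= 1 ->
  local_inverse_cauchy tau P (cauchy_inverse (1 - 2 * alpha)).
Proof.
move=> tau1 PP tauP /andP[alpha0 alpha1]; set x := 1 - 2 * alpha.
have x1 : `|x| <= 1 by rewrite ler_norml /x; lra.
split.
- apply/near_dnbhs0P; exists 1 => // y y0 y1.
  have s1 := rnorm_1_sqrt_branch (disc x y).
  have sE : sqrt_branch (disc x y) = 2 * y * cauchy_inverse x y - (1 + y).
    by rewrite /cauchy_inverse; field.
  (* The values 0 and 1 would make the branch [- (1 + y)] or [y - 1]; either way [1 + s] would have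
     modulus [rnorm y < 1]. *)
  have K0 : cauchy_inverse x y != 0.
    apply: contraTneq s1 => K0; rewrite sE K0 -ltNge.
    by rewrite (_ : _ + _ = - y) ?rnormN //; ring.
  have K1 : cauchy_inverse x y != 1.
    apply: contraTneq s1 => K1; rewrite sE K1 -ltNge.
    by rewrite (_ : _ + _ = y) //; ring.
  split; first exact: (resolvent_idempotent PP K0 K1).1.
  rewrite cauchy_transform_projection // tauP; apply/cauchy_discriminant => //.
  by rewrite -sE sqrt_branchK.
(* Radius 10 leaves [z] and [z - 1] of modulus above 9, so the two fractions in [t1] are at most 1/9
   each. *)
- exists 10 => z; rewrite -toCplx_rnorm toCplx_lt => z10.
  have z0 : z != 0 by rewrite -rnorm_gt0; lra.
  have zm9 : 9 < rnorm (z - 1).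
    by have := rnormD (z - 1) 1; rewrite subrK rnorm1; lra.
  have zm : z - 1 != 0 by rewrite -rnorm_gt0; lra.
  have z1 : z != 1 by rewrite -subr_eq0.
  split; first exact: (resolvent_idempotent PP z0 z1).1.
  rewrite cauchy_transform_projection // tauP; set y := _ + _.
  (* The only zero of the Cauchy transform is [1 - alpha], which lies in the unit disc. *)
  have y0 : y != 0.
    apply: contraTneq z10 => y0; rewrite -leNgt.
    have -> : z = toCplx (1 - alpha).
      have yz : y * (z * (z - 1)) = z - toCplx (1 - alpha).
        by rewrite rmorphB rmorph1 /y; field; rewrite z0 zm.
      by apply/eqP; rewrite -subr_eq0 -yz y0 mul0r.
    by rewrite rnorm_toCplx ger0_norm; lra.
  have tD : (2 * y * z - (1 + y)) ^+ 2 = disc x y by apply/cauchy_discriminant.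
  have t1 : rnorm (2 * y * z - (1 + y) - 1) < 1.
    have -> : 2 * y * z - (1 + y) - 1 = toCplx alpha / (z - 1) - toCplx (1 - alpha) / z.
      by rewrite rmorphB rmorph1 /y; field; rewrite z0 zm.
    apply: le_lt_trans (rnormB _ _) _.
    have q (b : R) (w : Cplx R) : 0 <= b <= 1 -> 9 < rnorm w -> rnorm (toCplx b / w) <= 9^-1.
      move=> /andP[b0 b1] w9; rewrite rnormM rnormV rnorm_toCplx ger0_norm //.
      by rewrite ler_pdivrMr; [lra | lra].
    have := q alpha (z - 1); have := q (1 - alpha) z.
    lra.
  by rewrite /cauchy_inverse -(sqrt_branch_unique tD t1); field.
- apply/cvgrPdist_lt => _ /gt0_toCplxP[e e0 ->]; apply/near_dnbhs0P.
  (* The distance is at most [(3 |y| + |y|) / 2 = 2 |y|]. *)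
  exists (Num.min 1 (e / 2)) => [|y y0]; first by rewrite lt_min ltr01 divr_gt0.
  rewrite lt_min => /andP[y1 ye]; rewrite -toCplx_rnorm toCplx_lt.
  have -> : 1 - y * cauchy_inverse x y = 2^-1 * (1 - sqrt_branch (disc x y) - y).
    by rewrite /cauchy_inverse; field.
  rewrite rnormM rnormV (rnorm_nat R 2).
  have := rnormB (1 - sqrt_branch (disc x y)) y.
  have := sqrt_branch_disc_near1 x1 (ltW y1); lra.
Qed.

(** The limit [y * K y --> 1] puts [2 * y * K y - (1 + y)] close to 1, which singles out the
    branch. *)
Lemma local_inverse_cauchy_projection_unique (R : realType) (A : starAlgType (Cplx R))
    (tau : {scalar A}) (P : A) (alpha : R) (K : Cplx R -> Cplx R) :
  tau 1 = 1 -> P * P = P -> tau P = toCplx alpha ->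
  local_inverse_cauchy tau P K ->
  \forall y \near (0 : Cplx R)^', K y = cauchy_inverse (1 - 2 * alpha) y.
Proof.
move=> tau1 PP tauP [/near_dnbhs0P[d d0 GK] _ /cvgrPdist_lt K1].
(* With 1/4 bounding both [|1 - y K y|] and [|y|], the root is within 3/4 of 1, and [K y] is neither
   0 nor 1. *)
have /K1/near_dnbhs0P[e e0 yK] : 0 < toCplx 4^-1 :> Cplx R.
  by rewrite -(rmorph0 (@toCplx R)) toCplx_lt.
apply/near_dnbhs0P; exists (Num.min 4^-1 (Num.min d e)).
  by rewrite !lt_min d0 e0 invr_gt0 ltr0n.
move=> y y0; rewrite !lt_min => /and3P[y4 yd ye].
have [_ GKy] := GK y y0 yd.
have := yK y y0 ye; rewrite -toCplx_rnorm toCplx_lt => {}yK.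
have z0 : K y != 0.
  by apply: contraTneq yK => ->; rewrite mulr0 subr0 rnorm1; lra.
have z1 : K y != 1.
  apply: contraTneq yK => ->; rewrite mulr1 -leNgt.
  by have := rnormD (1 - y) y; rewrite subrK rnorm1; lra.
move: GKy; rewrite cauchy_transform_projection // tauP => /cauchy_discriminant -/(_ z0 z1 y0) tD.
have t1 : rnorm (2 * y * K y - (1 + y) - 1) < 1.
  have -> : 2 * y * K y - (1 + y) - 1 = - (2 * (1 - y * K y) + y) by ring.
  rewrite rnormN; apply: le_lt_trans (rnormD _ _) _; rewrite rnormM (rnorm_nat R 2); lra.
by rewrite /cauchy_inverse -(sqrt_branch_unique tD t1); field.
Qed.

Lemma projection_cumulantE (R : realType) (alpha : R) (kappa : nat -> Cplx R) :
  (kappa 1%N = toCplx alpha /\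
   (forall n : nat, (2 <= n)%N ->
     kappa n = toCplx ((2 * (2 * n%:R - 1))^-1 *
                 (legendre n.-2 (1 - 2 * alpha) - legendre n (1 - 2 * alpha))))) <->
  forall n, kappa n.+1 = toCplx (projection_cumulant (1 - 2 * alpha) n.+1).
Proof.
have c1 : projection_cumulant (1 - 2 * alpha) 1 = alpha.
  by rewrite /projection_cumulant /=; field.
have c2 n : projection_cumulant (1 - 2 * alpha) n.+2 =
    (2 * (2 * n.+2%:R - 1))^-1 * (legendre n (1 - 2 * alpha) - legendre n.+2 (1 - 2 * alpha)).
  by rewrite /projection_cumulant /= addr0 invfM mulrC mulrA.
split=> [[k1 k2] [|n]|k]; first by rewrite c1.
  by rewrite c2 k2.
by split=> [|[|[|n]] // _]; rewrite k ?c1 ?c2.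
Qed.

Theorem mainTheorem11 (R : realType) (A : starAlgType (Cplx R))
    (tau : {scalar A}) (htau : tracial_state tau)
    (P : A) (hP : self_adjoint_projection P)
    (alpha : R) (halpha : tau P = toCplx alpha)
    (kappa : nat -> Cplx R) :
  free_cumulants tau P kappa <->
  kappa 1%N = toCplx alpha /\
  (forall n : nat, (2 <= n)%N ->
     kappa n = toCplx ((2 * (2 * n%:R - 1))^-1 *
                 (legendre n.-2 (1 - 2 * alpha) - legendre n (1 - 2 * alpha)))).
Proof.
have bnd := tracial_state_projection_bounds htau hP halpha.
have [tau1 _ _] := htau; have [_ PP] := hP.
rewrite projection_cumulantE; set x := 1 - 2 * alpha.
have x1 : `|x| <= 1 by move/andP: bnd => [? ?]; rewrite ler_norml /x; lra.
split=> [[K HK /near_dnbhs0P[d d0 kK]] n|kE].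
  have /near_dnbhs0P[e e0 KE] := local_inverse_cauchy_projection_unique tau1 PP halpha HK.
  apply/eqP; rewrite -subr_eq0; apply/eqP.
  (* Within 1/24 the explicit series converges, within [d] the given one does, and within [e] their
     limits agree, so the difference of the series tends to 0. *)
  move: n; apply: (@power_series_eq0 _ _ (Num.min 24^-1 (Num.min d e))).
    by rewrite !lt_min d0 e0 invr_gt0 ltr0n.
  move=> y y0; rewrite !lt_min => /and3P[y24 yd ye].
  rewrite [X in X @ _](_ : _ = series (fun k => kappa k.+1 * y ^+ k) \-
    series (fun k => toCplx (projection_cumulant x k.+1) * y ^+ k)).
    rewrite -(subrr (cauchy_inverse x y - y^-1)); apply: cvgB.
      by rewrite -KE //; apply: kK.
    exact: r_transform_cvg (ltW y24).
  by apply/funext => m; rewrite /series /= -sumrB; under eq_bigr do rewrite mulrBl.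
exists (cauchy_inverse x); first exact: cauchy_inverse_local_inverse.
apply/near_dnbhs0P; exists 24^-1 => // y y0 y24.
have := r_transform_cvg x1 y0 (ltW y24).
by under eq_fun do rewrite -kE.
Qed.
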